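(* There exists a function $f:\mathbb{N}\times\mathbb{N}\to\mathbb{N}$ such that for every integer $\ell\ge 0$, every integer $d\ge 0$ and every graph $G$ of distance VC-dimension $d$, the vertex set of $G$ can be covered by $f(\nu_\ell,d)$ balls of radius $\ell$; that is, $\tau_\ell\le f(\nu_\ell,d)$, where $\tau_\ell$ and $\nu_\ell$ are the transversality and the packing number of the $B_\ell$-hypergraph of $G$.
   Context: All graphs are finite and simple; $d_G$ is shortest-path distance ($+\infty$ between components) and $B_G(x,k)=\{y: d_G(x,y)\le k\}$. The $B_\ell$-hypergraph of $G=(V,E)$ has vertex set $V$ and one hyperedge $B_G(v,\ell)$ per $v\in V$; the $B$-hypergraph has hyperedges all balls $B_G(v,k)$, $v\in V$, $k\ge 0$. A set $X$ is shattered by a hypergraph if for every $X'\subseteq X$ there is a hyperedge $e$ with $e\cap X=X'$; the VC-dimension is the maximum size of a shattered set. The distance VC-dimension of $G$ is the maximum over all induced subgraphs $G'$ of $G$ of the VC-dimension of the $B$-hypergraph of $G'$. The transversality $\tau$ of a hypergraph is the minimum size of a set of vertices meeting every hyperedge; the packing number $\nu$ is the maximum number of pairwise disjoint hyperedges. (A hitting set of the $B_\ell$-hypergraph is the same as a set $X$ such that every vertex is at distance at most $\ell$ from $X$.) *)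

(* Defs.v *)
From mathcomp Require Import all_boot.
From mathcomp Require Import boolp.

Set Implicit Arguments.
Unset Strict Implicit.
Unset Printing Implicit Defensive.

Record sgraph := SGraph {
  vertex :> finType;
  edge : rel vertex;
  edge_sym : symmetric edge;
  edge_irrefl : irreflexive edge
}.

Lemma induced_edge_sym (G : sgraph) (S : {set G}) :
  symmetric (fun x y : {z : G | z \in S} => edge (val x) (val y)).
Proof. by move=> x y; exact: edge_sym. Qed.

Lemma induced_edge_irrefl (G : sgraph) (S : {set G}) :
  irreflexive (fun x y : {z : G | z \in S} => edge (val x) (val y)).
Proof. by move=> x; exact: edge_irrefl. Qed.

Definition induced (G : sgraph) (S : {set G}) : sgraph :=
  SGraph (@induced_edge_sym G S) (@induced_edge_irrefl G S).

Definition walk (G : sgraph) (n : nat) (x y : G) : bool :=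
  [exists p : n.-tuple G, path (@edge G) x p && (last x p == y)].

Lemma connect_walk (G : sgraph) (x y : G) :
  connect (@edge G) x y -> exists n, walk n x y.
Proof.
case/connectP => p ep ->; exists (size p); apply/existsP.
by exists (in_tuple p); rewrite ep eqxx.
Qed.

(* [None] stands for the distance +oo between distinct components; a walk of
   minimum length is automatically a shortest path. *)
Definition dist (G : sgraph) (x y : G) : option nat :=
  if decP (@idP (connect (@edge G) x y)) is left cxy
  then Some (ex_minn (connect_walk cxy)) else None.

Definition ball (G : sgraph) (x : G) (k : nat) : {set G} :=
  [set y | if dist x y is Some n then n <= k else false].

Definition ball_hypergraph_at (G : sgraph) (l : nat) : {set {set G}} :=
  [set ball v l | v : G].

Definition ball_hypergraph (G : sgraph) : {set {set G}} :=
  [set E | `[< exists (v : G) (k : nat), E = ball v k >]].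

Definition shattered (T : finType) (H : {set {set T}}) (X : {set T}) : bool :=
  [forall (Y : {set T} | Y \subset X), [exists E in H, E :&: X == Y]].

(* Equal to 0 when [H] has no hyperedge, in which case not even [set0] is
   shattered. *)
Definition vcdim (T : finType) (H : {set {set T}}) : nat :=
  \max_(X : {set T} | shattered H X) #|X|.

Definition distance_vcdim (G : sgraph) : nat :=
  \max_(S : {set G}) vcdim (ball_hypergraph (induced S)).

Definition hitting (T : finType) (H : {set {set T}}) (X : {set T}) : bool :=
  [forall E in H, X :&: E != set0].

(* The default value #|T| is the size of the largest candidate set, hence
   irrelevant as soon as some hitting set exists, i.e., as soon as [H] does not
   contain the empty hyperedge (balls are never empty). *)
Definition transversality (T : finType) (H : {set {set T}}) : nat :=
  \big[minn/#|T|]_(X : {set T} | hitting H X) #|X|.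

Definition packing_number (T : finType) (H : {set {set T}}) : nat :=
  \max_(P : {set {set T}} | (P \subset H) && trivIset P) #|P|.

(* Main.v *)
Require Import Defs.
From mathcomp Require Import all_boot zify.
From mathcomp Require Import boolp.

Set Implicit Arguments.
Unset Strict Implicit.
Unset Printing Implicit Defensive.

(* Fix a large constant K.  If for every probability distribution on V some
   vertex u has a ball B(u, l) of mass at least 1/K, multiplicative weights give
   a distribution for which every ball of radius l has mass at least 1/(4K), and
   the epsilon-net theorem yields a hitting set of size depending on K and d only.

   Otherwise some distribution gives mass less than 1/K to every ball.  Choose a
   geodesic for each pair of vertices at distance at most 2l, and sample N vertices
   x_1, ..., x_N: the middle vertices of the geodesic from x_i to x_j lie in B(x_k, l)
   with probability less than 1/K, so for K > 2N^3 there is a sample where this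
   never happens for k distinct from i and j.  By Ramsey, there are either nu + 1
   disjoint balls, which is excluded, or many x_i at pairwise distances at most 2l,
   which moreover are all equal to 2l or all smaller than 2l.  For a bipartite
   graph R on these x_i, consider the subgraph induced by the chosen geodesics
   joining the pairs in R.  There, for x_a and x_b on different sides, the distance
   is at most 2l exactly when (a, b) is in R: a walk joining a non-adjacent pair
   runs through the middle of a geodesic between two other vertices, at distance
   at least l + 1 from both x_a and x_b.  Taking for R an incidence graph, balls of
   radius 2l shatter d + 1 vertices. *)

(** * Shattered sets and counting *)

Lemma shattered_subset (T : finType) (F F' : {set {set T}}) (X : {set T}) :
  F \subset F' -> shattered F X -> shattered F' X.
Proof.
move=> sFF' /forall_inP shX; apply/forall_inP => Y /shX /exists_inP[E EF EY].
by apply/exists_inP; exists E => //; exact: (subsetP sFF').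
Qed.

Lemma shattered0 (T : finType) (F : {set {set T}}) E : E \in F -> shattered F set0.
Proof.
move=> EF; apply/forall_inP => Y; rewrite subset0 => /eqP->.
by apply/exists_inP; exists E => //; rewrite setI0.
Qed.

(** Induction, splitting [F] by an element [x] on which two members differ. No set shattered by
    either half contains [x], and a set [X] shattered by both halves accounts for two sets shattered
    by [F]: [X] and [x |: X]. *)
Lemma pajor (T : finType) (F : {set {set T}}) :
  #|F| <= #|[set X | shattered F X]|.
Proof.
have [n] := ubnP #|F|; elim: n F => // n IHn F Fn.
have [F1|F1] := leqP #|F| 1.
  have [->|[E EF]] := set_0Vmem F; first by rewrite cards0.
  apply: (leq_trans F1); rewrite card_gt0; apply/set0Pn; exists set0.
  by rewrite inE (shattered0 EF).
have /card_gt1P[E1 [E2 [E1F E2F neqE]]] := F1.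
have {neqE E1F E2F} [x [E [E' [EF xE E'F xE']]]] :
    exists x, exists E, exists E', [/\ E \in F, x \in E, E' \in F & x \notin E'].
  have : ~~ ((E1 \subset E2) && (E2 \subset E1)) by rewrite -eqEsubset.
  rewrite negb_and => /orP[] /subsetPn[x xE xE'].
    by exists x, E1, E2.
  by exists x, E2, E1.
pose Fx := [set E in F | x \in E]; pose Fy := F :\: Fx.
have sFx : Fx \subset F by apply/subsetP => A; rewrite inE => /andP[].
have sFy : Fy \subset F by exact: subsetDl.
have cF : #|F| = #|Fx| + #|Fy|.
  by rewrite -(cardsID Fx F) (setIidPr sFx).
have Fx0 : 0 < #|Fx| by apply/card_gt0P; exists E; rewrite inE EF.
have Fy0 : 0 < #|Fy| by apply/card_gt0P; exists E'; rewrite !inE (negPf xE') andbF.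
have shx (X : {set T}) : shattered Fx X -> x \notin X.
  move=> /forall_inP sh; apply/negP => xX.
  have /exists_inP[A] := sh set0 (sub0set _).
  by rewrite inE => /andP[_ xA] /eqP/setP/(_ x); rewrite !inE xA xX.
have shy (X : {set T}) : shattered Fy X -> x \notin X.
  move=> /forall_inP sh; apply/negP => xX.
  have /exists_inP[A] := sh X (subxx _).
  rewrite !inE => /andP[xA AF] /eqP/setP/(_ x).
  by rewrite AF /= in xA; rewrite !inE (negPf xA) xX.
rewrite cF.
have /leq_trans-> // : #|Fx| + #|Fy| <=
    #|[set X | shattered Fx X]| + #|[set X | shattered Fy X]|.
  by apply: leq_add; apply: IHn; lia.
rewrite -cardsUI.
set U := _ :|: _; set I := _ :&: _.
have injI : {in I &, injective (fun X : {set T} => x |: X)}.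
  move=> X Y; rewrite !inE => /andP[/shx xX _] /andP[/shx xY _] eXY.
  by rewrite -(setU1K xX) -(setU1K xY) eXY.
rewrite -(card_in_imset injI) -cardsUI.
rewrite (_ : _ :&: _ = set0) ?cards0 ?addn0; last first.
  apply/setP => X; rewrite !inE; apply/negP => /andP[XU /imsetP[Y _ eX]].
  have xX : x \in X by rewrite eX !inE eqxx.
  by case/orP: XU => [/shx|/shy]; rewrite xX.
apply/subset_leq_card/subsetP => X; rewrite !inE => /orP[/orP[]|].
- exact: shattered_subset.
- exact: shattered_subset.
case/imsetP => Y; rewrite !inE => /andP[shY1 shY2] ->.
have xY := shx _ shY1.
apply/forall_inP => Z ZY; have [xZ|xZ] := boolP (x \in Z).
  have /(forall_inP shY1)/exists_inP[A] : Z :\ x \subset Y by rewrite subDset.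
  rewrite inE => /andP[AF xA] /eqP eA; apply/exists_inP; exists A => //.
  by rewrite setIUr eA (setIidPr _) ?sub1set // setD1K.
have /(forall_inP shY2)/exists_inP[A] : Z \subset Y.
  by rewrite -(setU1K xY) subsetD1 ZY.
rewrite !inE => /andP[xA AF] /eqP eA; apply/exists_inP; exists A => //.
rewrite AF /= in xA.
rewrite setIUr eA (_ : A :&: [set x] = set0) ?set0U //.
by apply/setP => z; rewrite !inE; case: eqP => [->|]; rewrite ?(negPf xA) ?andbF.
Qed.

Lemma card_small_sets (T : finType) (d : nat) :
  #|[set X : {set T} | #|X| <= d]| <= #|T|.+1 ^ d.
Proof.
pose im (h : {ffun 'I_d -> option T}) := [set x | [exists i, h i == Some x]].
have -> : #|T|.+1 ^ d = #|{ffun 'I_d -> option T}|.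
  by rewrite card_ffun card_option card_ord.
rewrite -cardsT; apply: leq_trans (leq_imset_card im _).
apply/subset_leq_card/subsetP => X; rewrite inE => Xd.
apply/imsetP; exists [ffun i : 'I_d => nth None (map Some (enum X)) i] => //.
apply/setP => x; rewrite inE; apply/idP/existsP => [xX|[i]].
  have xi : index x (enum X) < #|X| by rewrite cardE index_mem mem_enum.
  exists (Ordinal (leq_trans xi Xd)); rewrite ffunE /=.
  by rewrite (nth_map x) ?nth_index ?mem_enum // -cardE.
rewrite ffunE; have [iX|iX] := ltnP i (size (enum X)).
  rewrite (nth_map x) // => /eqP[<-].
  by rewrite -mem_enum mem_nth.
by rewrite nth_default ?size_map.
Qed.

(** Provides the parameter [q] of [eps_net]. With [q] a power of 2 only exponents are compared, and
    [2 ^ r >= s.+1 ^ 2] for [r = 2 * s] beats a linear function of [r]. *)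
Lemma poly_lt_expn (K d : nat) :
  exists q, 2 * K * (4 * K * q).+1 ^ d < 2 ^ q.
Proof.
pose C := (K.+1 + (K + 3) * d).+1; pose s := 2 * d + C; pose r := 2 * s.
exists (2 ^ r).
have leK : K <= 2 ^ K by exact/ltnW/ltn_expl.
have r0 : 0 < 2 ^ r by rewrite expn_gt0.
have k0 : 0 < 2 ^ K by rewrite expn_gt0.
have h1 : (4 * K * 2 ^ r).+1 <= 2 ^ (K + 3 + r).
  by rewrite !expnD; nia.
have h2 : 2 * K * (4 * K * 2 ^ r).+1 ^ d <= 2 ^ (K.+1 + (K + 3 + r) * d).
  rewrite expnD expnM; apply: leq_mul; first by rewrite expnS; lia.
  by case: (d) => // e; rewrite leq_exp2r.
apply: (leq_ltn_trans h2); rewrite ltn_exp2l //.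
have sS : s < 2 ^ s by exact: ltn_expl.
have -> : 2 ^ r = 2 ^ s * 2 ^ s by rewrite -expnD addnn -mul2n.
have eC : C = (K.+1 + (K + 3) * d).+1 by [].
have es : s = 2 * d + C by [].
have er : r = 2 * s by [].
move: (2 ^ s) sS eC es er => S; clearbody C s r; clear => sS eC es er.
have : s.+1 * s.+1 <= S * S by apply: leq_mul.
rewrite es er; nia.
Qed.

(** * Sampling and multiplicative weights *)

Lemma card_set_sum (T : finType) (P : pred T) : #|[set x | P x]| = \sum_x P x.
Proof. by rewrite -sum1dep_card big_mkcond; apply: eq_bigr => x _; case: (P x). Qed.

Definition resample (I W : finType) (f : {ffun I -> W}) (k : I) (y : W) :=
  [ffun i => if i == k then y else f i].

(** For uniform [f], the value [f k] is independent of a set determined by the other coordinates;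
    the involution exchanges [f k] with a fresh value. *)
Lemma card_resample (I W : finType) (k : I) (S : {ffun I -> W} -> {set W}) :
    (forall f y, S (resample f k y) = S f) ->
  #|[set f : {ffun I -> W} | f k \in S f]| * #|W| = \sum_f #|S f|.
Proof.
move=> Sk.
pose phi (p : {ffun I -> W} * W) := (resample p.1 k p.2, p.1 k).
have phiK : involutive phi.
  case=> f y; rewrite /phi /=; congr pair; last by rewrite ffunE eqxx.
  by apply/ffunP => i; rewrite !ffunE; case: eqP => [->|].
pose A := setX [set f : {ffun I -> W} | f k \in S f] [set: W].
rewrite -cardsT -cardsX -/A -(card_preimset A (inv_inj phiK)).
rewrite (_ : _ @^-1: _ = [set p : {ffun I -> W} * W | p.2 \in S p.1]).
  rewrite card_set_sum -(pair_bigA _ (fun f y => nat_of_bool (y \in S f))) /=.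
  by apply: eq_bigr => f _; rewrite -card_set_sum; apply: eq_card => y; rewrite inE.
by apply/setP => -[f y]; rewrite !inE /= Sk ffunE eqxx andbT.
Qed.

(** Union bound over the [2 * N ^ 3] tuples [(c, i, j, k)], each bad with probability at most [1/K].
    The map [w] from a uniform [W] encodes a distribution on [V] with rational weights. *)
Lemma sampling (V W : finType) (w : W -> V) (E : rel V)
    (m : bool -> V -> V -> V) (N K : nat) :
    2 * N ^ 3 < K -> 0 < #|W| ->
    (forall u, K * #|[set z | E u (w z)]| < #|W|) ->
  exists x : 'I_N -> V, forall c i j k, k != i -> k != j ->
    ~~ E (m c (x i) (x j)) (x k).
Proof.
move=> ltK W0 light.
pose idx := (bool * ('I_N * 'I_N * 'I_N))%type.
pose bad (t : idx) (f : {ffun 'I_N -> W}) :=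
  let: (c, (i, j, k)) := t in
  [&& k != i, k != j & E (m c (w (f i)) (w (f j))) (w (f k))].
have bad_le t : K * #|[set f | bad t f]| <= #|W| ^ N.
  case: t => c [[i j] k] /=.
  have [->|neki] := eqVneq k i.
    by rewrite (_ : [set f | _] = set0) ?cards0 ?muln0 //; apply/setP => f; rewrite !inE.
  have [->|nekj] := eqVneq k j.
    by rewrite (_ : [set f | _] = set0) ?cards0 ?muln0 //; apply/setP => f; rewrite !inE.
  pose S (f : {ffun 'I_N -> W}) := [set z | E (m c (w (f i)) (w (f j))) (w z)].
  have SK f y : S (resample f k y) = S f.
    by rewrite /S !ffunE ![_ == k]eq_sym (negPf neki) (negPf nekj).
  have := card_resample SK.
  rewrite (_ : [set f | _] = [set f : {ffun _ -> _} | E (m c (w (f i)) (w (f j))) (w (f k))]);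
    last by apply/setP => f; rewrite !inE.
  move=> eS; rewrite -(leq_pmul2r W0) -mulnA eS.
  rewrite -expnSr big_distrr /=.
  have -> : #|W| ^ N.+1 = \sum_(f : {ffun 'I_N -> W}) #|W|.
    by rewrite sum_nat_const card_ffun card_ord expnSr.
  by apply: leq_sum => f _; apply: ltnW; apply: light.
have [f fgood] : exists f, forall t, ~~ bad t f.
  apply: contrapT => nogood.
  have cover (f : {ffun 'I_N -> W}) : 1 <= \sum_t bad t f.
    have [t bt] : exists t, bad t f.
      apply: contrapT => nt; apply: nogood; exists f => t.
      by apply/negP => bt; apply: nt; exists t.
    by rewrite (bigD1 t) //= bt.
  have : K * #|{ffun 'I_N -> W}| <= \sum_(t : idx) K * #|[set f | bad t f]|.
    rewrite -big_distrr /= leq_mul2l; apply/orP; right.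
    under eq_bigr do rewrite card_set_sum.
    rewrite exchange_big /= -sum1_card; exact: leq_sum.
  rewrite card_ffun card_ord => /leq_trans/(_ (leq_sum _ (fun t _ => bad_le t))).
  rewrite sum_nat_const !card_prod card_bool !card_ord.
  rewrite leq_pmul2r ?expn_gt0 ?W0 //; lia.
exists (fun i => w (f i)) => c i j k ki kj.
by have := fgood (c, (i, j, k)); rewrite /= ki kj.
Qed.

(* A weight is doubled whenever it is not hit, so that
   after [t] rounds a vertex hit [h] times has weight [2 ^ (t - h)]. *)
Fixpoint mweight (V : finType) (E : rel V) (s : seq V) (v : V) : nat :=
  if s is u :: s' then (if E u v then 1 else 2) * mweight E s' v else 1.

Lemma mweight_count (V : finType) (E : rel V) (s : seq V) (v : V) :
  mweight E s v * 2 ^ count (E^~ v) s = 2 ^ size s.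
Proof.
elim: s => //= u s IHs; rewrite expnS -IHs.
by case: (E u v); rewrite ?add1n ?add0n ?expnS; lia.
Qed.

Lemma mweight_gt0 (V : finType) (E : rel V) (s : seq V) (v : V) :
  0 < mweight E s v.
Proof. by elim: s => //= u s IHs; case: (E u v); lia. Qed.

Lemma bernoulli (n k : nat) : n ^ k.+1 + k.+1 * n ^ k <= n.+1 ^ k.+1.
Proof.
elim: k => [|k IHk]; first by rewrite !expn1 expn0; lia.
rewrite [n.+1 ^ _]expnS; have := leq_mul (leqnn n.+1) IHk.
by rewrite !expnS; nia.
Qed.

(** Taking [w v] copies of each [v] turns integer weights into a uniform distribution. *)
Lemma heavy_weight (V : finType) (E : rel V) (K : nat) :
    (forall (W : finType) (w : W -> V), 0 < #|W| ->
       exists u, #|W| <= K * #|[set z | E u (w z)]|) ->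
  forall w : V -> nat, 0 < \sum_v w v ->
    exists u, \sum_v w v <= K * \sum_(v | E u v) w v.
Proof.
move=> heavy w w0; pose W : finType := {v : V & 'I_(w v)}.
have cW (P : pred V) : #|[set z : W | P (tag z)]| = \sum_(v | P v) w v.
  rewrite -sum1dep_card.
  under eq_bigl do rewrite -[P _]andbT.
  rewrite -(sig_big_dep (fun v => P v) (fun v (i : 'I_(w v)) => true) (fun v i => 1)) /=.
  by apply: eq_bigr => v _; rewrite sum1_card card_ord.
have cT : #|W| = \sum_v w v.
  by rewrite -(cW predT) -cardsT; apply: eq_card => z; rewrite !inE.
have [|u] := heavy W (fun z => tag z); first by rewrite cT.
by rewrite cT (cW (E u)); exists u.
Qed.

(** Each round multiplies the total weight by at most [2 - 1/K], whereas a vertex hit [h] times in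
    [t] rounds has weight [2 ^ (t - h)]; so no vertex is hit rarely. *)
Lemma multiplicative_weights (V : finType) (E : rel V) (K : nat) :
    0 < K -> 0 < #|V| ->
    (forall (W : finType) (w : W -> V), 0 < #|W| ->
       exists u, #|W| <= K * #|[set z | E u (w z)]|) ->
  exists s : seq V, 0 < size s /\
    forall v, size s <= 4 * K * count (E^~ v) s.
Proof.
move=> K0 V0 /heavy_weight heavy.
have step t : exists s : seq V, size s = t /\
    K ^ t * \sum_v mweight E s v <= (2 * K).-1 ^ t * #|V|.
  elim: t => [|t [s [<- IHs]]].
    by exists [::]; split => //=; rewrite sum1_card !expn0.
  have [u hu] : exists u, \sum_v mweight E s v <= K * \sum_(v | E u v) mweight E s v.
    apply: heavy; rewrite -sum1_card in V0.
    by apply: leq_trans V0 _; apply: leq_sum => v _; exact: mweight_gt0.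
  exists (u :: s); split => //.
  set X := \sum_v _ in IHs hu; set Y := \sum_(v | _) _ in hu.
  have -> : \sum_v mweight E (u :: s) v = 2 * X - Y.
    apply/eqP; rewrite -(eqn_add2r Y) subnK; last first.
      rewrite /X /Y [X in 2 * X](bigID (E u)) /=; lia.
    rewrite /X /Y [X in _ + X]big_mkcond -big_split big_distrr /=; apply/eqP.
    by apply: eq_bigr => v _; case: (E u v); lia.
  have h : K * (2 * X - Y) <= (2 * K).-1 * X by nia.
  rewrite !expnS -!mulnA [K * _]mulnCA.
  apply: (leq_trans (leq_mul (leqnn _) h)).
  by rewrite mulnCA; apply: leq_mul.
(* This many rounds reduce the claim to [#|V| <= h]. Their dependence on [#|V|] is harmless: only
   the frequency of hits matters. *)
have [s [es hs]] := step (4 * K * #|V|).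
exists s; split => [|v]; first by rewrite es; lia.
rewrite es leq_pmul2l; last by lia.
set h := count _ s.
have : K ^ size s * mweight E s v <= (2 * K).-1 ^ size s * #|V|.
  rewrite es; apply: leq_trans hs; rewrite leq_mul2l; apply/orP; right.
  by rewrite (bigD1 v) //= leq_addr.
have e2 : 2 * K = (2 * K).-1.+1 by lia.
move=> /(leq_mul)/(_ (leqnn (2 ^ h))).
rewrite -mulnA mweight_count -expnMn [K * 2]mulnC {1}e2.
have ->: size s = (2 * K) * (2 * #|V|) by rewrite es; lia.
rewrite expnM [X in _ <= X * _ * _]expnM.
set n := (2 * K).-1 in e2 *; rewrite e2.
have n0 : 0 < n by rewrite /n; lia.
have b : 2 * n ^ n.+1 <= n.+1 ^ n.+1.
  apply: leq_trans (bernoulli n n); rewrite expnS; nia.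
have {}b : 2 ^ (2 * #|V|) * (n ^ n.+1) ^ (2 * #|V|) <= (n.+1 ^ n.+1) ^ (2 * #|V|).
  rewrite -expnMn leq_exp2r //; lia.
have N0 : 0 < (n ^ n.+1) ^ (2 * #|V|) by rewrite !expn_gt0 n0.
move/(leq_trans b); rewrite -[X in _ <= X]mulnA [X in _ <= X]mulnC leq_pmul2r // [#|V| * _]mulnC.
have : #|V| <= 2 ^ #|V| by exact/ltnW/ltn_expl.
move=> /(leq_mul (leqnn (2 ^ h))) V2 /leq_trans/(_ V2).
rewrite -expnD leq_exp2l //; lia.
Qed.

(** * Epsilon-nets and Ramsey's theorem *)

(** One admissible [s0] fixes at least [q] coordinates of all the others: where [(i, ~~ s0 i)] is in
    [t], avoiding [t] forces [s i = s0 i]. *)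
Lemma card_swaps (I : finType) (q : nat) (t : {set I * bool}) :
  #|[set s : {ffun I -> bool} | [forall i, (i, s i) \notin t]
       && (q <= #|[set i | (i, ~~ s i) \in t]|)]| * 2 ^ q <= 2 ^ #|I|.
Proof.
set A := [set s | _]; have [->|[s0]] := set_0Vmem A; first by rewrite cards0.
rewrite inE => /andP[/forallP s0t qS]; set S := [set i | _] in qS.
pose F (i : I) : pred bool := if i \in S then pred1 (s0 i) else predT.
have sAF : A \subset family F.
  apply/subsetP => s; rewrite inE => /andP[/forallP st _].
  apply/familyP => i; rewrite /F; case: ifP; rewrite !inE // => it.
  apply/eqP; move: (st i) it; case: (s i) (s0 i) => [] [] // + it.
    by rewrite it.
  by rewrite it.
apply: leq_trans (leq_mul (subset_leq_card sAF) (leq_pexp2l (isT : 0 < 2) qS)) _.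
rewrite card_family foldrE big_map big_enum /= -prod_nat_const.
rewrite [X in _ * X]big_mkcond -big_split -prod_nat_const /=.
by apply: leq_prod => i _; rewrite /F; case: ifP => _;
  rewrite ?card1 // muln1 (leq_trans (max_card _)) ?card_bool.
Qed.

(* Double sampling: [h (i, false)] is a first sample, [h (i, true)] a second one,
   and swapping the two independently at each [i] preserves the distribution. *)
Lemma eps_net (V W : finType) (w : W -> V) (E : rel V) (K d q : nat) :
    0 < K -> 2 * K * (4 * K * q).+1 ^ d < 2 ^ q -> 0 < #|W| ->
    (forall X : {set V},
       (forall Y : {set V}, Y \subset X -> exists v, {in X, forall x, E x v = (x \in Y)}) ->
       #|X| <= d) ->
    (forall v, #|W| <= K * #|[set z | E (w z) v]|) ->
  exists C : {set V}, #|C| <= 2 * K * q /\ forall v, exists2 u, u \in C & E u v.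
Proof.
move=> K0 ltq W0 vc dense; set N := 2 * K * q.
have q0 : 0 < q by case: (q) ltq => //; rewrite expn0; nia.
apply: contrapT => nonet.
pose I : finType := ('I_N * bool)%type; pose H : finType := {ffun I -> W}.
(* As no sample is a net, each first sample [f] misses some vertex [c f]. *)
have /choice[c cP] (f : {ffun 'I_N -> W}) : exists v, forall i, ~~ E (w (f i)) v.
  apply: contrapT => nov.
  apply: nonet; exists [set w (f i) | i in 'I_N]; split.
    by rewrite (leq_trans (leq_imset_card _ _)) // card_ord.
  move=> v; apply: contrapT => nou; apply: nov; exists v => i; apply/negP => Ei.
  by apply: nou; exists (w (f i)) => //; apply: imset_f.
pose v (h : H) := c [ffun i => h (i, false)].
pose S (h : H) := [set z | E (w z) (v h)].
pose hits (h : H) := #|[set i | h (i, true) \in S h]|.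
have cH : #|{: H}| = #|W| ^ (N * 2) by rewrite card_ffun card_prod card_ord card_bool.
set M := #|{: H}| in cH.
have M0 : 0 < M by rewrite cH expn_gt0 W0.
have hitE i : M <= K * #|[set h : H | h (i, true) \in S h]|.
  have Si h y : S (resample h (i, true) y) = S h.
    suff vE : v (resample h (i, true) y) = v h by rewrite /S vE.
    rewrite /v; congr (c _); apply/ffunP => j; rewrite !ffunE.
    by rewrite xpair_eqE andbF.
  rewrite -(leq_pmul2r W0) -mulnA (card_resample Si) big_distrr /=.
  by rewrite /M -sum_nat_const; apply: leq_sum => h _; exact: dense.
pose good (h : H) := [exists u, [forall i, ~~ E (w (h (i, false))) u]
   && (q <= #|[set i | E (w (h (i, true))) u]|)].
(* The mean of [hits] is at least [N / K = 2 * q] and [hits] never exceeds [N], so it reaches [q]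
   with probability at least [1 / (2 * K)]. *)
have goodM : M <= 2 * K * #|[set h | good h]|.
  have e1 : N * M <= K * \sum_h hits h.
    have -> : \sum_h hits h = \sum_(i < N) #|[set h : H | h (i, true) \in S h]|.
      under eq_bigr do rewrite /hits card_set_sum.
      by rewrite exchange_big; apply: eq_bigr => i _; rewrite card_set_sum.
    by rewrite big_distrr /= -{1}(card_ord N) -sum_nat_const; apply: leq_sum => i _.
  have e2 : \sum_h hits h <= N * #|[set h | good h]| + q * M.
    rewrite card_set_sum big_distrr /= mulnC /M -sum_nat_const -big_split /=.
    apply: leq_sum => h _; have [qh|qh] := leqP q (hits h); last first.
      by apply: leq_trans (ltnW qh) _; rewrite leq_addl.
    have -> : good h.
      apply/existsP; exists (v h); apply/andP; split.
        by apply/forallP => i; have := cP [ffun i => h (i, false)] i; rewrite ffunE.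
      by apply: leq_trans qh _; apply/subset_leq_card/subsetP => i; rewrite !inE.
    rewrite muln1; apply: (@leq_trans N); last by rewrite leq_addr.
    by rewrite -[X in _ <= X](card_ord N) max_card.
  move: (#|[set h | good h]|) e1 e2 => G e1 e2.
  have : N * M <= K * (N * G + q * M) by apply: leq_trans e1 _; rewrite leq_mul2l e2 orbT.
  rewrite /N => e3.
  have : (K * q) * M <= (K * q) * (2 * K * G) by nia.
  by rewrite leq_pmul2l // muln_gt0 K0.
pose swap (s : {ffun 'I_N -> bool}) (h : H) : H := [ffun p => h (p.1, p.2 (+) s p.1)].
have swapK s : involutive (swap s).
  by move=> h; apply/ffunP => -[i b]; rewrite !ffunE /= addbK.
(* For a fixed double sample only the trace of [u] on it matters; [pajor] leaves polynomially many
   traces, and each survives few swaps. *)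
have few h : #|[set s | good (swap s h)]| * 2 ^ q <= (4 * K * q).+1 ^ d * 2 ^ N.
  pose trace u : {set I} := [set p | E (w (h p)) u].
  pose F : {set {set I}} := [set trace u | u in V].
  have cF : #|F| <= (4 * K * q).+1 ^ d.
    have -> : 4 * K * q = #|I| by rewrite card_prod card_ord card_bool /N; lia.
    apply: leq_trans (pajor F) (leq_trans _ (card_small_sets I d)).
    apply/subset_leq_card/subsetP => X; rewrite !inE => /forall_inP shX.
    have shX' (Y : {set I}) : Y \subset X ->
        exists u, {in X, forall p, E (w (h p)) u = (p \in Y)}.
      move=> /shX/exists_inP[_ /imsetP[u _ ->] /eqP eY]; exists u => p pX.
      by rewrite -eY !inE pX andbT.
    (* Positions holding the same vertex cannot be separated, so a shattered set of positions maps
       injectively to vertices. *)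
    have injX : {in X &, injective (fun p => w (h p))}.
      move=> p p' pX p'X epp'.
      have [|u hu] := shX' [set p]; first by rewrite sub1set.
      have := hu _ p'X; rewrite -epp' hu // !inE eqxx.
      by move/esym/eqP.
    rewrite -(card_in_imset injX); apply: vc => Y YX.
    have [|u hu] := shX' [set p in X | w (h p) \in Y].
      by apply/subsetP => p; rewrite inE => /andP[].
    by exists u => _ /imsetP[p pX ->]; rewrite hu // inE pX.
  apply: (@leq_trans (\sum_(t in F) 2 ^ N)); last first.
    by rewrite sum_nat_const leq_mul2r cF orbT.
  pose sw (t : {set I}) := [set s : {ffun 'I_N -> bool} |
    [forall i, (i, s i) \notin t] && (q <= #|[set i | (i, ~~ s i) \in t]|)].
  have sub : [set s | good (swap s h)] \subset \bigcup_(t in F) sw t.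
    apply/subsetP => s; rewrite inE => /existsP[u /andP[/forallP nE qE]].
    apply/bigcupP; exists (trace u); first exact: imset_f.
    rewrite inE; apply/andP; split.
      by apply/forallP => i; have := nE i; rewrite !ffunE inE.
    by apply: leq_trans qE _; apply/subset_leq_card/subsetP => i; rewrite !inE ffunE.
  apply: leq_trans (leq_mul (subset_leq_card sub) (leqnn _)) _.
  have cU : #|\bigcup_(t in F) sw t| <= \sum_(t in F) #|sw t|.
    elim/big_rec2: _ => [|t a b _ ba]; first by rewrite cards0.
    by rewrite (leq_trans (leq_card_setU _ _)) // leq_add2l.
  apply: leq_trans (leq_mul cU (leqnn _)) _.
  rewrite big_distrl /=; apply: leq_sum => t _.
  by rewrite -[X in _ <= 2 ^ X](card_ord N); exact: card_swaps.
have final : #|[set h | good h]| * 2 ^ q <= M * (4 * K * q).+1 ^ d.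
  have N2 : 0 < 2 ^ N by rewrite expn_gt0.
  rewrite -(leq_pmul2r N2).
  have -> : #|[set h | good h]| * 2 ^ q * 2 ^ N =
      (\sum_(s : {ffun 'I_N -> bool}) #|[set h | good (swap s h)]|) * 2 ^ q.
    rewrite (eq_bigr (fun _ => #|[set h | good h]|)).
      by rewrite sum_nat_const card_ffun card_bool card_ord; lia.
    move=> s _; rewrite -[RHS](card_preimset _ (inv_inj (swapK s))).
    by apply: eq_card => h; rewrite !inE.
  under eq_bigr do rewrite card_set_sum.
  rewrite exchange_big big_distrl /= -mulnA -sum_nat_const.
  by apply: leq_sum => h _; rewrite -card_set_sum.
have : M * 2 ^ q <= M * (2 * K * (4 * K * q).+1 ^ d).
  by have := leq_mul goodM (leqnn (2 ^ q)); nia.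
by rewrite leq_pmul2l // leqNgt ltq.
Qed.

Lemma ramsey (s t : nat) :
  exists N, forall (T : finType) (e : rel T), symmetric e ->
    forall A : {set T}, N <= #|A| -> exists B : {set T}, B \subset A /\
      (#|B| = s /\ {in B &, forall x y, x != y -> e x y} \/
       #|B| = t /\ {in B &, forall x y, x != y -> ~~ e x y}).
Proof.
have base (T : finType) (A : {set T}) (P : T -> T -> Prop) :
    (set0 \subset A) /\ #|(set0 : {set T})| = 0 /\ {in set0 &, forall x y, x != y -> P x y}.
  by rewrite sub0set cards0; split=> //; split => // x y; rewrite inE.
have [n] := ubnP (s + t); elim: n s t => // n IHn [|s] t.
  move=> _; exists 0 => T e _ A _; have [h1 h2] := base T A e.
  by exists set0; split => //; left.
case: t => [|t] stn.
  exists 0 => T e _ A _; have [h1 h2] := base T A (fun x y => ~~ e x y).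
  by exists set0; split => //; right.
have [|N1 h1] := IHn s t.+1; first by lia.
have [|N2 h2] := IHn s.+1 t; first by lia.
exists (N1 + N2).+1 => T e sym_e A NA.
have /card_gt0P[x xA] : 0 < #|A| by lia.
pose A1 := [set y in A :\ x | e x y]; pose A2 := (A :\ x) :\: A1.
have cA : #|A| = (#|A1| + #|A2|).+1.
  rewrite (cardsD1 x) xA -(cardsID A1 (A :\ x)) (setIidPr _) //.
  by apply/subsetP => y; rewrite inE => /andP[].
have A1P y : y \in A1 -> [/\ y != x, y \in A & e x y].
  by rewrite !inE => /andP[/andP[-> ->] ->].
have A2P y : y \in A2 -> [/\ y != x, y \in A & ~~ e x y].
  by rewrite !inE; case: (e x y); case: (y == x); case: (y \in A).
have [NA1|NA1] := leqP N1 #|A1|.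
  have [B [/subsetP BA [[cB hB]|[cB hB]]]] := h1 T e sym_e A1 NA1.
    exists (x |: B); split.
      by apply/subsetP => y; rewrite !inE => /orP[/eqP->//|/BA/A1P[]].
    left; rewrite cardsU1 cB.
    have -> /= : x \notin B by apply/negP => /BA/A1P[]; rewrite eqxx.
    split=> // y z; rewrite !inE => /orP[/eqP->|yB] /orP[/eqP->|zB]; rewrite ?eqxx //.
    - by move=> _; have [] := A1P z (BA z zB).
    - by move=> _; rewrite sym_e; have [] := A1P y (BA y yB).
    - exact: hB.
  exists B; split; last by right.
  by apply/subsetP => y /BA/A1P[].
have NA2 : N2 <= #|A2| by lia.
have [B [/subsetP BA [[cB hB]|[cB hB]]]] := h2 T e sym_e A2 NA2.
  exists B; split; last by left.
  by apply/subsetP => y /BA/A2P[].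
exists (x |: B); split.
  by apply/subsetP => y; rewrite !inE => /orP[/eqP->//|/BA/A2P[]].
right; rewrite cardsU1 cB.
have -> /= : x \notin B by apply/negP => /BA/A2P[]; rewrite eqxx.
split=> // y z; rewrite !inE => /orP[/eqP->|yB] /orP[/eqP->|zB]; rewrite ?eqxx //.
- by move=> _; have [] := A2P z (BA z zB).
- by move=> _; rewrite sym_e; have [] := A2P y (BA y yB).
- exact: hB.
Qed.

(** * Balls and truncated distance *)

(** Describes balls of an induced subgraph on vertices of [G], avoiding the subtype. [S] constrains
    every vertex of the walk after its start. *)
Definition reach (G : sgraph) (S : {set G}) (k : nat) (x y : G) : Prop :=
  exists p, [/\ path (@edge G) x p, all (mem S) p, last x p = y & size p <= k].

Lemma in_ball (G : sgraph) (x y : G) k : y \in ball x k <-> reach [set: G] k x y.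
Proof.
rewrite /ball /dist inE; case: decP => [cxy|ncxy]; last first.
  split=> // -[p [ep _ lp _]]; case: ncxy; apply/connectP; by exists p.
case: ex_minnP => m /existsP[p /andP[ep /eqP lp]] minm; split=> [mk|].
  exists p; split => //; last by rewrite size_tuple.
  by apply/allP => z _; rewrite inE.
case=> q [eq _ lq qk]; apply: leq_trans qk; apply: minm.
by apply/existsP; exists (in_tuple q); rewrite eq lq eqxx.
Qed.

Lemma reach_trans (G : sgraph) (S : {set G}) m n x y z :
  reach S m x y -> reach S n y z -> reach S (m + n) x z.
Proof.
move=> [p [ep Sp lp pm]] [q [eq Sq lq qn]]; exists (p ++ q).
by rewrite cat_path ep lp eq all_cat Sp Sq last_cat lp lq size_cat leq_add.
Qed.

Lemma reachT_sym (G : sgraph) k (x y : G) : reach [set: G] k x y -> reach [set: G] k y x.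
Proof.
case=> p [ep _ lp pk]; exists (rev (belast x p)); split.
- by rewrite -lp rev_path (eq_path (e' := @edge G)) // => u v; exact: edge_sym.
- by apply/allP => z _; rewrite inE.
- case: p {ep pk} lp => //= z p _; by rewrite rev_cons last_rcons.
- by rewrite size_rev size_belast.
Qed.

Lemma reachW (G : sgraph) (S : {set G}) m n x y : m <= n -> reach S m x y -> reach S n x y.
Proof. by move=> mn [p [ep Sp lp pm]]; exists p; split => //; exact: leq_trans mn. Qed.

Lemma in_ball_induced (G : sgraph) (S : {set G}) (x y : induced S) k :
  y \in ball x k <-> reach S k (val x) (val y).
Proof.
rewrite in_ball; split=> -[p [ep Sp lp pk]].
  exists (map val p); split.
  - by rewrite (map_path (e' := @edge (induced S)) (b := pred0)) //; apply/hasPn => z.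
  - by apply/allP => _ /mapP[z _ ->]; exact: (valP z).
  - by rewrite last_map lp.
  - by rewrite size_map.
have [q qp] : exists q : seq (induced S), map val q = p.
  elim: p Sp {ep lp pk} => [|z p IHp] /=; first by exists [::].
  by case/andP => zS /IHp[q <-]; exists (exist _ z zS :: q).
exists q; split.
- by move: ep; rewrite -qp (map_path (e' := @edge (induced S)) (b := pred0)) //; apply/hasPn => z.
- by apply/allP => z _; rewrite inE.
- by apply: val_inj; rewrite -lp -qp last_map.
- by rewrite -(size_map val) qp.
Qed.

Lemma leq_distance_vcdim (G : sgraph) (S X : {set G}) :
    X \subset S ->
    (forall Y : {set G}, Y \subset X ->
       exists c, c \in S /\ exists k, {in X, forall x, reach S k c x <-> x \in Y}) ->
  #|X| <= distance_vcdim G.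
Proof.
move=> /subsetP XS sh.
pose X' : {set induced S} := [set z | val z \in X].
have cX : #|X| = #|X'|.
  rewrite -(card_imset X' val_inj); apply: eq_card => x; apply/idP/imsetP => [xX|[z]].
    by exists (exist _ x (XS x xX)); rewrite ?inE.
  by rewrite inE => zX ->.
rewrite cX /distance_vcdim.
apply: leq_trans (leq_bigmax S); apply: leq_bigmax_cond.
apply/forall_inP => Y' /subsetP YX'.
have YX : [set val z | z in Y'] \subset X.
  by apply/subsetP => _ /imsetP[z /YX' + ->]; rewrite inE.
have [c [cS [k ck]]] := sh _ YX.
apply/exists_inP; exists (ball (exist _ c cS : induced S) k).
  by rewrite inE; apply/asboolP; exists (exist _ c cS), k.
apply/eqP/setP => z; rewrite inE; apply/andP/idP => [[zb zX]|zY].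
  rewrite inE in zX; move/in_ball_induced/(ck _ zX): zb.
  by case/imsetP => z' z'Y /val_inj->.
have zX := YX' _ zY; split => //; apply/in_ball_induced.
by rewrite inE in zX; apply/(ck _ zX); exact: imset_f.
Qed.

(* The distance truncated at [L]: unlike the distance itself it is always
   finite, and it is still a metric. *)
Definition tdist (G : sgraph) (L : nat) (x y : G) : nat :=
  find (fun k => y \in ball x k) (iota 0 L).

Section TruncatedDistance.
Variables (G : sgraph) (L : nat).
Local Notation td := (@tdist G L).

Lemma tdist_leL x y : td x y <= L.
Proof. by rewrite -[X in _ <= X](size_iota 0) find_size. Qed.

Lemma ball_mono (x y : G) m n : m <= n -> y \in ball x m -> y \in ball x n.
Proof. by move=> mn /in_ball/(reachW mn)/in_ball. Qed.

Lemma tdist_le x y k : y \in ball x k -> td x y <= k.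
Proof.
move=> xyk; rewrite leqNgt; apply/negP => kxy.
have kL := leq_trans kxy (tdist_leL x y).
have := before_find 0 kxy; by rewrite nth_iota // add0n xyk.
Qed.

Lemma tdist_ball x y k : td x y <= k -> k < L -> y \in ball x k.
Proof.
move=> xyk kL; apply: (ball_mono xyk).
have xyL : td x y < L by lia.
have : has (fun k => y \in ball x k) (iota 0 L) by rewrite has_find size_iota.
by move/(nth_find 0); rewrite nth_iota.
Qed.

Lemma tdistxx x : td x x = 0.
Proof.
apply/eqP; rewrite -leqn0; apply: tdist_le; apply/in_ball.
by exists [::].
Qed.

Lemma tdist0 x y : td x y = 0 -> 0 < L -> x = y.
Proof.
move=> xy0 /tdist_ball-/(_ x y); rewrite xy0 => /(_ isT)/in_ball[[|z p] [_ _ + //]].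
Qed.

Lemma tdist_sym x y : td x y = td y x.
Proof.
suff le u v : td u v <= td v u by apply/eqP; rewrite eqn_leq !le.
have [vuL|vuL] := ltnP (td v u) L; last exact: leq_trans (tdist_leL u v) vuL.
by apply: tdist_le; apply/in_ball/reachT_sym/in_ball; exact: tdist_ball.
Qed.

Lemma tdist_tri y x z : td x z <= td x y + td y z.
Proof.
have [xyL|xyL] := ltnP (td x y) L; last by have := tdist_leL x z; lia.
have [yzL|yzL] := ltnP (td y z) L; last by have := tdist_leL x z; lia.
apply: tdist_le; apply/in_ball; apply: (@reach_trans _ _ _ _ _ y); apply/in_ball; exact: tdist_ball.
Qed.

Lemma tdist_edge x y : edge x y -> td x y <= 1.
Proof.
move=> xy; apply: tdist_le; apply/in_ball; exists [:: y].
by rewrite /= xy inE.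
Qed.

Lemma geodesic x y : td x y < L -> exists g : nat -> G,
  [/\ g 0 = x, g (td x y) = y & forall t, t < td x y -> edge (g t) (g t.+1)].
Proof.
move=> xyL; have /in_ball[p [ep _ lp pxy]] := tdist_ball (leqnn _) xyL.
have sp : size p = td x y.
  apply/eqP; rewrite eqn_leq pxy; apply: tdist_le; apply/in_ball.
  by exists p; split => //; apply/allP => z _; rewrite inE.
exists (fun t => nth x (x :: p) t); split=> //.
  by rewrite -sp -lp (last_nth x).
by move=> t tp; have /pathP := ep; apply; rewrite sp.
Qed.

End TruncatedDistance.

(** * Unions of geodesics *)

Section GeodesicUnion.
Variables (G : sgraph) (l : nat) (I : finType) (x : I -> G).
Variables (side : pred I) (R : rel I) (g : G -> G -> nat -> G).
Local Notation dst := (@tdist G (2 * l).+1).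

(** Half the length, rounded down, is measured from [u] or from [v]: on a geodesic of odd length
    these are the two ends of the central edge, one for each orientation. *)
Definition middle (c : bool) (u v : G) : G :=
  g u v (if c then dst u v %/ 2 else dst u v - dst u v %/ 2).

Hypothesis sideR : forall i j, R i j -> ~~ side i /\ side j.
Hypothesis gP : forall u v, dst u v <= 2 * l ->
  [/\ g u v 0 = u, g u v (dst u v) = v &
      forall t, t < dst u v -> edge (g u v t) (g u v t.+1)].
Hypothesis closeR : forall i j, dst (x i) (x j) <= 2 * l.
Hypothesis extremal : (forall i j, i != j -> dst (x i) (x j) = 2 * l) \/
                      (forall i j, i != j -> dst (x i) (x j) < 2 * l).
Hypothesis farR : forall c i j k, k != i -> k != j ->
  l < dst (x k) (middle c (x i) (x j)).

Let len i j := dst (x i) (x j).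
Let adj i j := R i j || R j i.
(* [R] only selects the orientation of [g]: [half i j] runs along the chosen path
   between [x i] and [x j] starting from the [x i] end. *)
Let half i j t := if R i j then g (x i) (x j) t else g (x j) (x i) (len i j - t).
Let mid i j := half i j (len i j %/ 2).
(** Ownership attaches the vertices of the union to indices, so that a walk can be followed through
    its owners. *)
Let owns i j u := adj i j /\ exists2 t, t <= len i j %/ 2 & u = half i j t.

Lemma adj_side i j : adj i j -> side j = ~~ side i.
Proof. by case/orP => /sideR[]; case: (side i); case: (side j). Qed.

Lemma adj_neq i j : adj i j -> i != j.
Proof. by move/adj_side; apply: contra_eqN => /eqP->; case: (side j). Qed.

Lemma R_asym i j : R i j -> R j i = false.
Proof. by move/sideR=> [si sj]; apply/negP => /sideR[]; rewrite sj. Qed.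

Lemma lenC i j : len i j = len j i.
Proof. exact: tdist_sym. Qed.

Lemma half0 i j : adj i j -> half i j 0 = x i.
Proof.
rewrite /half; case: ifP => [_ _|_ /= Rji].
  by have [] := gP (closeR i j).
by rewrite subn0 lenC; have [_ -> _] := gP (closeR j i).
Qed.

Lemma half_opp i j t : adj i j -> t <= len i j -> half i j t = half j i (len i j - t).
Proof.
move=> Rij tn; rewrite /half (lenC j i).
case/orP: Rij => Rij; rewrite (R_asym Rij) Rij // subKn //.
Qed.

Lemma half_edge i j t : adj i j -> t < len i j -> edge (half i j t) (half i j t.+1).
Proof.
rewrite /half; case: ifP => [_ _|_ Rji] tn.
  by have [_ _] := gP (closeR i j); apply.
have [_ _ h] := gP (closeR j i).
rewrite edge_sym -(subnSK tn); apply: h; rewrite -/(len j i) (lenC j i); lia.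
Qed.

Lemma half_dist i j s t : adj i j -> s <= t <= len i j -> dst (half i j s) (half i j t) <= t - s.
Proof.
move=> Rij /andP[]; elim: t => [|t IHt]; first by rewrite leqn0 => /eqP->; rewrite tdistxx.
rewrite leq_eqVlt => /orP[/eqP-> _|st tn]; first by rewrite tdistxx.
have := IHt st (ltnW tn); have := tdist_edge (2 * l).+1 (half_edge Rij tn).
have := tdist_tri (2 * l).+1 (half i j t) (half i j s) (half i j t.+1).
lia.
Qed.

Lemma mid_far i j k : adj i j -> k != i -> k != j -> l < dst (x k) (mid i j).
Proof.
rewrite /mid /half; case: ifP => [_ _|_ /= Rji] ki kj.
  exact: (farR true ki kj).
by rewrite lenC; exact: (farR false kj ki).
Qed.

Lemma mid_dist i j : adj i j ->
  dst (x i) (mid i j) <= len i j %/ 2 /\ dst (mid i j) (x j) <= len i j - len i j %/ 2.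
Proof.
move=> Rij; have <- : half i j (len i j) = x j by rewrite half_opp // subnn half0 // /adj orbC.
split; last by apply: half_dist; rewrite // leq_div /=.
by rewrite -(half0 Rij) -[X in _ <= X]subn0; apply: half_dist; rewrite // leq_div.
Qed.

(** Turns ownership into inequalities, leaving linear arithmetic to [crossing]; the last clause
    recognises the middle vertex from [t] alone. *)
Lemma ownsP i j u : owns i j u -> adj i j /\ exists t,
  [/\ t <= len i j %/ 2, dst (x i) u <= t, dst u (mid i j) <= len i j %/ 2 - t,
      dst u (x j) <= len i j - t & t = len i j %/ 2 -> u = mid i j].
Proof.
case=> Rij [t tn ->]; split => //; exists t.
have tn' : t <= len i j by apply: leq_trans tn (leq_div _ _).
split=> //; last by move->.
- by rewrite -(half0 Rij) -{2}(subn0 t); apply: half_dist; rewrite ?tn'.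
- by apply: half_dist; rewrite // tn leq_div.
have -> : x j = half i j (len i j) by rewrite half_opp // subnn half0 // /adj orbC.
by apply: half_dist; rewrite ?tn' /=.
Qed.

(* The second alternative is what forces [extremal]: by [farR], an edge between
   half paths of unrelated indices [i] and [k] joins points at equal distance [s]
   from [x i] and [x k], and only if the two chosen paths have length [2 * l];
   then [2 * l = dst (x i) (x k) <= 2 * s + 1] pushes both points to the middle. *)
Lemma crossing i j k m u v :
    owns i j u -> owns k m v -> dst u v <= 1 -> i != k ->
  adj i k /\ [\/ u = mid i k, u = mid k i, v = mid i k | v = mid k i] \/
  [/\ u = mid i j, len i j = 2 * l, v = mid k m & len k m = 2 * l].
Proof.
move=> /ownsP[Rij [s [s1 s2 s3 s4 s5]]] /ownsP[Rkm [t [t1 t2 t3 t4 t5]]] uv ik.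
have nij : len i j <= 2 * l by exact: closeR.
have nkm : len k m <= 2 * l by exact: closeR.
have vu : dst v u <= 1 by rewrite tdist_sym.
have h1 := tdist_tri (2 * l).+1 u (x i) (x k).
have h2 := tdist_tri (2 * l).+1 v u (x k).
have h3 : dst v (x k) <= t by rewrite tdist_sym.
have h4 := tdist_tri (2 * l).+1 v (x i) (mid k m).
have h5 := tdist_tri (2 * l).+1 u (x i) v.
have h6 := tdist_tri (2 * l).+1 u (x k) (mid i j).
have h7 := tdist_tri (2 * l).+1 v (x k) u.
have h8 : dst (x k) v <= t by [].
have h9 : len i k <= s + 1 + t by rewrite /len; clear -h1 h2 s2 uv h3; lia.
have [ekj|kj] := eqVneq k j.
  subst j; have [eim|im] := eqVneq i m.
    subst m; left; split => //; rewrite (lenC k i) in t1 t3 t4 t5.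
    have [es|es] := eqVneq s (len i k %/ 2); first by constructor 1; exact: s5.
    by constructor 4; apply: t5; clear -es s1 t1 h9; lia.
  (* As [x i] is more than [l] away from [mid k m], an edge to the half path from [k] to [m] can
     only leave from [mid i k]. *)
  left; split => //; constructor 1; apply: s5.
  have := mid_far Rkm ik im; clear -s1 s2 t1 t3 h4 h5 h9 nkm uv; lia.
have ki : k != i by rewrite eq_sym.
have := mid_far Rij ki kj.
have [eim|im] := eqVneq i m.
  subst m; rewrite (lenC k i) in t1 t3 t4 t5 nkm => kij.
  left; split; first by rewrite /adj orbC.
  constructor 4; apply: t5; clear -s1 s3 t1 t2 h6 h7 h8 h9 kij nij vu; lia.
have := mid_far Rkm ik im => kij ikm.
have e1 : len i j = 2 * l.
  by clear -s1 s2 s3 t1 t2 t3 h4 h5 h6 h7 h8 nij nkm kij ikm uv vu; lia.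
have e2 : len k m = 2 * l.
  by clear -s1 s2 s3 t1 t2 t3 h4 h5 h6 h7 h8 nij nkm kij ikm uv vu; lia.
right; case: extremal => ext; last first.
  by have := ext _ _ (adj_neq Rij); rewrite -/(len i j) e1 ltnn.
have e3 : len i k = 2 * l by exact: ext.
by split => //; [apply: s5 | apply: t5];
  clear -s1 s2 s3 t1 t2 t3 h4 h5 h6 h7 h8 h9 e1 e2 e3 kij ikm uv vu; lia.
Qed.

Let S := [set u | `[< exists i j, owns i j u >]].

Lemma union_owned u : u \in S -> exists i j, owns i j u.
Proof. by rewrite inE => /asboolP. Qed.

Lemma owned_in_union i j u : owns i j u -> u \in S.
Proof. by move=> h; rewrite inE; apply/asboolP; exists i, j. Qed.

Lemma reach_edge a b : R a b -> reach S (2 * l) (x a) (x b).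
Proof.
move=> Rab; have adj_ab : adj a b by rewrite /adj Rab.
have hS t : t <= len a b -> half a b t \in S.
  move=> tn; have [th|th] := leqP t (len a b %/ 2).
    by apply: (@owned_in_union a b); split=> //; exists t.
  apply: (@owned_in_union b a); split; first by rewrite /adj Rab orbT.
  exists (len a b - t); last by rewrite half_opp.
  rewrite (lenC b a); lia.
exists (mkseq (fun t => half a b t.+1) (len a b)); split.
- rewrite -(half0 adj_ab); apply/(pathP (x a)) => t; rewrite size_mkseq => tn.
  rewrite nth_mkseq //; case: t tn => [|t] tn; first exact: half_edge.
  by rewrite /= nth_mkseq ?(ltnW tn) //; exact: half_edge.
- by apply/(all_nthP (x a)) => t; rewrite size_mkseq => tn; rewrite nth_mkseq //; exact: hS.
- rewrite (last_nth (x a)) size_mkseq.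
  have hn : half a b (len a b) = x b by rewrite half_opp // subnn half0 // /adj Rab orbT.
  case en : (len a b) hn => [|t] hn; first by rewrite -hn half0.
  by rewrite /= nth_mkseq.
- by rewrite size_mkseq; exact: closeR.
Qed.

(** In [farR] the first two indices may coincide; the middle is then the point itself. *)
Lemma x_inj i j : x i = x j -> i = j.
Proof.
move=> xij; apply/eqP; apply/negPn/negP => nij.
have := farR true nij nij; rewrite xij /middle tdistxx div0n.
have [] := gP (u := x j) (v := x j); first by rewrite tdistxx.
by move=> -> _ _; rewrite tdistxx.
Qed.

(* Along the walk the owner stays among [a] and its neighbours: crossing at the
   middle of a path between two indices other than [a] and [b] would require
   length at least [2 * l.+1]. *)
Lemma no_short_walk a b p w i j :
    ~~ side a -> side b -> ~~ R a b ->
    owns i j w -> (i == a) || R a i ->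
    path (@edge G) w p -> all (mem S) p -> last w p = x b ->
    dst (x a) w + size p <= 2 * l -> False.
Proof.
move=> sa sb nRab.
have nRba : R b a = false by apply/negP => /sideR[]; rewrite sb.
have ab : a != b by apply: contraNneq sa => ->.
elim: p w i j => [|v p IHp] w i j owi ai /=.
  (* The walk has reached [x b], whose owner [i] is not [b]: either [mid i j] is too close to [x b],
     or [j = b] and [x i = x b]. *)
  move=> _ _ wb _; have [Rij [t [t1 t2 t3 t4 t5]]] := ownsP owi.
  have ib : b != i by apply: contraTneq ai => <-; rewrite negb_or eq_sym ab nRab.
  have nij : len i j <= 2 * l by exact: closeR.
  rewrite wb in t2 t3 t4 t5.
  have [ebj|bj] := eqVneq b j; last first.
    by have := mid_far Rij ib bj; clear -t1 t3 nij; lia.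
  subst j; have : len i b = 0 by move: t1 t2; rewrite -/(len i b); clear; lia.
  by move/tdist0 => /(_ isT)/x_inj/eqP; rewrite eq_sym (negPf ib).
case/andP => wv vp /andP[vS Sp] lp szp.
have dwv := tdist_edge (2 * l).+1 wv.
have h1 := tdist_tri (2 * l).+1 w (x a) v.
have h2 : dst v (x b) <= size p.
  apply: tdist_le; apply/in_ball; exists p; split => //.
  by apply/allP => z _; rewrite inE.
have [k [m okv]] := union_owned vS.
suff ak : (k == a) || R a k by apply: (IHp v k m) => //; clear -szp h1 dwv; lia.
have [<- //|ik] := eqVneq i k.
case: (crossing owi okv dwv ik) => [[Rik eqm]|[ew e1 ev e2]]; last first.
  have [Rij _] := owi; have [Rkm _] := okv.
  (* Middles of paths of length [2 * l] are at distance at least [l] from every [x c], so passing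
     through both [w] and [v] makes the walk too long. *)
  have far c i' j' : adj i' j' -> len i' j' = 2 * l -> l <= dst (x c) (mid i' j').
    move=> Rij' e; have [d1 d2] := mid_dist Rij'.
    have := tdist_tri (2 * l).+1 (mid i' j') (x i') (x j').
    rewrite -/(len i' j') e; rewrite e mulKn // in d1 d2.
    have [->|ci] := eqVneq c i'; first by clear -d2; lia.
    have [->|cj] := eqVneq c j'; first by rewrite (tdist_sym _ (x j')); clear -d1; lia.
    by move=> _; apply/ltnW/mid_far.
  have := far a _ _ Rij e1; have := far b _ _ Rkm e2; rewrite -ew -ev.
  rewrite (tdist_sym _ (x b)); clear -szp h2; lia.
(* The walk meets a middle [u] of the path between [i] and [k]. Its length leaves [x a] or [x b]
   within [l] of [u], so [a] or [b] is one of [i] and [k]. *)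
have [u [du1 du2 eu]] : exists u, [/\ dst (x a) u + dst u (x b) <= 2 * l,
    True & u = mid i k \/ u = mid k i].
  have h3 := tdist_tri (2 * l).+1 v w (x b).
  by case: eqm => e; [exists w|exists w|exists v|exists v]; split; auto;
    clear -szp h1 h2 h3 dwv; lia.
have Rki : adj k i by rewrite /adj orbC.
have far c : c != i -> c != k -> l < dst (x c) u.
  by move=> ci ck; case: eu => ->; apply: mid_far.
rewrite (tdist_sym _ u) in du1.
have {}far : [|| a == i, a == k, b == i | b == k].
  have [//|ai'] := eqVneq a i; have [//|ak'] := eqVneq a k.
  have [//|bi'] := eqVneq b i; have [//|bk'] := eqVneq b k.
  have := far a ai' ak'; have := far b bi' bk'; clear -du1; lia.
case/orP: ai => [/eqP eia|Rai].
  subst i; case/orP: Rik => [->|/sideR[_ /negPn]]; first by rewrite orbT.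
  by rewrite (negPf sa).
(* Here [i] is on the side of [b] and [k] on that of [a]; only [k = a] is consistent. *)
have [_ si] := sideR Rai; have sk := adj_side Rik; rewrite si in sk.
case/or4P: far => /eqP e.
- by rewrite e si in sa.
- by rewrite e eqxx.
- by rewrite e Rai in nRab.
- by rewrite e sk in sb.
Qed.

(** A neighbour for each index puts every [x i] in the union. *)
Lemma realize_bipartite : (forall i, exists j, R i j || R j i) ->
  exists S : {set G}, (forall i, x i \in S) /\
    forall a b, ~~ side a -> side b -> (reach S (2 * l) (x a) (x b) <-> R a b).
Proof.
move=> noniso; have ox i : exists j, owns i j (x i).
  have [j Rij] := noniso i; exists j; split=> //.
  by exists 0; rewrite ?half0.
exists S; split=> [i|a b sa sb]; first by have [j /owned_in_union] := ox i.
split=> [[p [ep Sp lp szp]]|]; last exact: reach_edge.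
apply/negPn/negP => nRab; have [j oj] := ox a.
by apply: (no_short_walk sa sb nRab oj _ ep Sp lp); rewrite ?eqxx ?tdistxx.
Qed.

End GeodesicUnion.

(** * The Erdos-Posa property of balls *)

Lemma leq_bigmin_cond (T : finType) (P : pred T) (F : T -> nat) (n : nat) (x : T) :
  P x -> \big[minn/n]_(y | P y) F y <= F x.
Proof.
move=> Px; have : x \in index_enum T by rewrite mem_index_enum.
elim: (index_enum T) => // y r IHr; rewrite inE big_cons => /orP[/eqP<-|/IHr le].
  by rewrite Px geq_minl.
by case: (P y) => //; rewrite geq_min le orbT.
Qed.

Lemma ball_sym (G : sgraph) (x y : G) k : (y \in ball x k) = (x \in ball y k).
Proof. by apply/idP/idP => /in_ball/reachT_sym/in_ball. Qed.

Lemma leq_packing_number (G : sgraph) (l : nat) (I : finType) (x : I -> G) (B : {set I}) :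
    {in B &, forall i j, i != j -> ~~ (tdist (2 * l).+1 (x i) (x j) <= 2 * l)} ->
  #|B| <= packing_number (ball_hypergraph_at G l).
Proof.
move=> farB.
have disj i j z : i \in B -> j \in B -> z \in ball (x i) l -> z \in ball (x j) l -> i = j.
  move=> iB jB zi; rewrite ball_sym => zj; apply/eqP/negPn/negP => /(farB i j iB jB).
  rewrite tdist_le //; apply/in_ball; rewrite mul2n -addnn.
  by apply: (reach_trans (y := z)); apply/in_ball.
have xx i : x i \in ball (x i) l by apply/in_ball; exists [::].
have injB : {in B &, injective (fun i => ball (x i) l)}.
  by move=> i j iB jB eij; apply: (disj i j (x i)) => //; rewrite -eij.
rewrite -(card_in_imset injB) /packing_number; apply: leq_bigmax_cond.
apply/andP; split; first by apply/subsetP => _ /imsetP[i _ ->]; exact: imset_f.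
apply/trivIsetP => _ _ /imsetP[i iB ->] /imsetP[j jB ->].
apply: contraNT => /pred0Pn[z /andP[/= zi zj]].
by rewrite (disj i j z).
Qed.

(* The [inl] indices are the centres of the shattering balls and the [Some] ones
   the shattered points; [None] is adjacent to all centres, so that the centre
   of the empty trace is not isolated. *)
Lemma homogeneous_family_bound (G : sgraph) (l D : nat) (g : G -> G -> nat -> G)
    (I : finType := ({set 'I_D} + option 'I_D)%type) (x : I -> G) :
    (forall u v, tdist (2 * l).+1 u v <= 2 * l ->
      [/\ g u v 0 = u, g u v (tdist (2 * l).+1 u v) = v &
      forall t, t < tdist (2 * l).+1 u v -> edge (g u v t) (g u v t.+1)]) ->
    (forall i j, tdist (2 * l).+1 (x i) (x j) <= 2 * l) ->
    (forall i j, i != j -> tdist (2 * l).+1 (x i) (x j) = 2 * l) \/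
    (forall i j, i != j -> tdist (2 * l).+1 (x i) (x j) < 2 * l) ->
    (forall c i j k, k != i -> k != j ->
       l < tdist (2 * l).+1 (x k) (middle l g c (x i) (x j))) ->
  D <= distance_vcdim G.
Proof.
move=> gP close ext far.
pose side (i : I) := if i is inr _ then true else false.
pose R (i j : I) := match i, j with
  | inl _, inr None => true
  | inl Y, inr (Some b) => b \in Y
  | _, _ => false end.
have sideR i j : R i j -> ~~ side i /\ side j by case: i j => [Y|b] [Y'|b'].
have [|S [xS RS]] := realize_bipartite sideR gP close ext far.
  case=> [Y|[b|]]; first by exists (inr None).
    by exists (inl setT); rewrite /= inE.
  by exists (inl setT).
have xinj := x_inj gP far.
pose y (b : 'I_D) := x (inr (Some b)).
have yinj : injective y by move=> b b' /xinj[].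
rewrite -{1}(card_ord D) -(card_imset _ yinj).
apply: (@leq_distance_vcdim G S).
  by apply/subsetP => _ /imsetP[b _ ->]; exact: xS.
move=> Y YX; exists (x (inl [set b | y b \in Y])); split; first exact: xS.
exists (2 * l) => _ /imsetP[b _ ->].
by rewrite (RS (inl _) (inr (Some b)) isT isT) /= inE.
Qed.

Lemma bounded_hitting (nu d : nat) : exists F, forall (l : nat) (G : sgraph),
    distance_vcdim G = d -> packing_number (ball_hypergraph_at G l) = nu ->
  exists C : {set G}, #|C| <= F /\ forall v, exists2 u, u \in C & u \in ball v l.
Proof.
pose I : finType := ({set 'I_d.+1} + option 'I_d.+1)%type.
(* [ramsey2] rules out [nu.+1] points pairwise farther than [2 * l] apart; [ramsey1] then separates
   distance exactly [2 * l] from smaller distances. *)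
have [N1 ramsey1] := ramsey #|I| #|I|.
have [N2 ramsey2] := ramsey N1 nu.+1.
pose K := (2 * N2 ^ 3).+1.
(* The factor 4 is the loss in [multiplicative_weights]. *)
have [q ltq] := poly_lt_expn (4 * K) d.
exists (2 * (4 * K) * q) => l G vcG nuG.
have [G0|G0] := posnP #|G|.
  exists set0; rewrite cards0; split=> // v.
  by have := fintype0 v; rewrite G0.
pose E (u v : G) := u \in ball v l.
have [heavy|light] := pselect (forall (W : finType) (w : W -> G), 0 < #|W| ->
    exists u, #|W| <= K * #|[set z | E u (w z)]|).
  have [s [s0 dense]] := multiplicative_weights (ltn0Sn _) G0 heavy.
  (* Sampling positions of [s] counts repeated vertices with multiplicity. *)
  apply: (@eps_net _ 'I_(size s) (tnth (in_tuple s)) E _ d) => //.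
  - by rewrite card_ord.
  - move=> X shX; rewrite -vcG; apply: (@leq_distance_vcdim G setT) => // Y /shX[v hv].
    exists v; split=> //; exists l => x xX; rewrite -in_ball -hv //.
  - move=> v; rewrite card_ord; apply: leq_trans (dense v) _.
    by rewrite -sum1_count big_tnth sum1dep_card.
exfalso; apply: light => W w W0; apply: contrapT => light.
pose L := (2 * l).+1.
have /choice[g gP] (uv : G * G) : exists g : nat -> G, tdist L uv.1 uv.2 <= 2 * l ->
    [/\ g 0 = uv.1, g (tdist L uv.1 uv.2) = uv.2 &
        forall t, t < tdist L uv.1 uv.2 -> edge (g t) (g t.+1)].
  case: uv => u v /=; have [/geodesic[g hg]|uvL] := ltnP (tdist L u v) L; first by exists g.
  by exists (fun=> u); rewrite leqNgt uvL.
have {}light u : K * #|[set z | E u (w z)]| < #|W|.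
  by rewrite ltnNge; apply/negP => hu; apply: light; exists u.
have [x far] := sampling (middle l (fun u v => g (u, v))) (ltnSn (2 * N2 ^ 3)) W0 light.
have {}far c i j k : k != i -> k != j ->
    l < tdist L (x k) (middle l (fun u v => g (u, v)) c (x i) (x j)).
  move=> ki kj; have := far c i j k ki kj; rewrite ltnNge; apply: contra => /tdist_ball.
  by apply; rewrite /L; lia.
have [||B [_ [[cB closeB]|[cB farB]]]] :=
    ramsey2 _ (fun i j => tdist L (x i) (x j) <= 2 * l) _ [set: 'I_N2].
- by move=> i j; rewrite tdist_sym.
- by rewrite cardsT card_ord.
- have [||B' [/subsetP B'B hB']] :=
    ramsey1 _ (fun i j => tdist L (x i) (x j) == 2 * l) _ B; rewrite ?cB //.
    by move=> i j; rewrite tdist_sym.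
  have cB' : #|I| = #|B'| by case: hB' => -[].
  pose f (i : I) := enum_val (cast_ord cB' (enum_rank i)).
  have fB' i : f i \in B' by exact: enum_valP.
  have finj : injective f by move=> i j /enum_val_inj/cast_ord_inj/enum_rank_inj.
  have close i j : tdist L (x (f i)) (x (f j)) <= 2 * l.
    have [->|ij] := eqVneq i j; first by rewrite tdistxx.
    by apply: closeB; rewrite ?B'B ?inj_eq.
  suff : d.+1 <= distance_vcdim G by rewrite vcG ltnn.
  apply: (@homogeneous_family_bound G l d.+1 (fun u v => g (u, v)) (fun i => x (f i))) => //.
  - by move=> u v; exact: (gP (u, v)).
  - case: hB' => -[_ hB']; [left|right] => i j ij.
      by apply/eqP/hB'; rewrite ?inj_eq.
    by rewrite ltn_neqAle close andbT hB' // inj_eq.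
  - by move=> c i j k ki kj; apply: far; rewrite inj_eq.
- by have := leq_packing_number farB; rewrite cB nuG ltnn.
Qed.

Theorem theorem11 :
  exists f : nat -> nat -> nat,
    forall (l d : nat) (G : sgraph),
      distance_vcdim G = d ->
      let H := ball_hypergraph_at G l in
      (exists C : {set G},
         #|C| <= f (packing_number H) d /\
         \bigcup_(v in C) ball v l = [set: G]) /\
      transversality H <= f (packing_number H) d.
Proof.
have [f fP] := choice (fun nu => let: existT h hP := choice (bounded_hitting nu) in
  ex_intro _ h hP).
exists f => l d G vcG H.
have [C [cC hitC]] := fP (packing_number H) d l G vcG erefl.
split.
  exists C; split => //; apply/setP => y; rewrite inE.
  have [u uC uy] := hitC y; apply/bigcupP; exists u => //.
  by rewrite ball_sym.
apply: leq_trans cC; apply: leq_bigmin_cond.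
apply/forall_inP => _ /imsetP[v _ ->]; have [u uC uv] := hitC v.
by apply/set0Pn; exists u; rewrite inE uC.
Qed.
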